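(* Let $n \ge 2$. For $2 \leq s \leq n$ let $O(n,s)$ denote the number of monomials in $\partial(\operatorname{stan}_n^{n-2})$ in which exactly $s$ of the variables $x_1,\dots,x_n$ have exponent $1$. Then $O(n,s)$ equals the number of uprooted trees on $[n]$ whose root has degree $s-1$, and this number is \[O(n,s) = \binom{n}{s} (s-1)(n-1)^{n-s-1}.\] The total number of elements of $\partial(\operatorname{stan}_n^{n-2})$ is \[|\partial(\operatorname{stan}_n^{n-2})| = (n-1)^{n-1}.\]
   Context: Fix a field $\mathbb{K}$ and let $S = \mathbb{K}[x_1,\dots,x_n]$, $[n]=\{1,\dots,n\}$. For nonempty $\sigma \subseteq [n]$ let $m_\sigma = \prod_{i\in\sigma} x_i^{\,n-|\sigma|+1}$. For $0 \le k \le n-1$ let $M_n^{(k)} = \langle m_\sigma : \sigma \subseteq [n],\ 1 \le |\sigma| \le k+1\rangle \subset S$. The standard monomials of a monomial ideal are the monomials of $S$ not lying in the ideal; $\operatorname{stan}_n^k$ denotes the set of standard monomials of $M_n^{(k)}$. Define $\partial(\operatorname{stan}_n^{n-2}) = \operatorname{stan}_n^{n-2} \setminus \operatorname{stan}_n^{n-1}$. An uprooted tree on $[n]$ is a rooted tree (a labeled tree with a distinguished root vertex) with vertex set $[n]$ such that the root is larger than each of its children (immediate descendants). The degree of the root is its number of children. For $s=n$ the factor $(n-1)^{n-s-1}$ means the rational number $1/(n-1)$. *)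

(* Defs.v *)
From mathcomp Require Export all_boot all_order all_algebra.
From mathcomp Require Export finmap.
From mathcomp Require Export boolp classical_sets cardinality.
From mathcomp Require Export mpoly.

Set Implicit Arguments.
Unset Strict Implicit.
Unset Printing Implicit Defensive.

Import GRing.Theory.

Local Open Scope classical_set_scope.
Local Open Scope ring_scope.

(* [fset_set A] is the finite set with the same elements as [A] when [A] is
   finite, and is empty otherwise: [ncard A = N] with [N > 0] therefore forces
   [A] to be finite with exactly [N] elements. *)
Definition ncard (T : choiceType) (A : set T) : nat := #|` fset_set A |.

Definition gen_ideal (R : comNzRingType) (I : finType) (P : pred I)
    (g : I -> R) : set R :=
  [set p | exists c : I -> R, p = \sum_(i | P i) c i * g i].

Section Monomials.

Variables (K : fieldType) (n : nat).

Definition m_gen (sigma : {set 'I_n}) : {mpoly K[n]} :=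
  \prod_(i in sigma) 'X_i ^+ (n - #|sigma| + 1).

Definition M_ideal (k : nat) : set {mpoly K[n]} :=
  gen_ideal [pred sigma : {set 'I_n} | 1 <= #|sigma| <= k.+1]%N m_gen.

(* Monomials of S are represented by their exponent vectors. *)
Definition stan (k : nat) : set 'X_{1..n} :=
  [set m | ~ M_ideal k ('X_[m] : {mpoly K[n]})].

Definition bd_stan : set 'X_{1..n} := stan (n - 2) `\` stan (n - 1).

Definition O_count (s : nat) : nat :=
  ncard [set m : 'X_{1..n} | bd_stan m /\ #|[pred i | m i == 1%N]| = s].

End Monomials.

Arguments M_ideal : clear implicits.
Arguments stan : clear implicits.
Arguments bd_stan : clear implicits.

Section Trees.

Variable V : finType.

(* A simple graph on V is given by its set E of edges, each edge being the
   2-element set of its endpoints. *)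
Definition simple_graph (E : {set {set V}}) : Prop :=
  forall e, e \in E -> #|e| = 2.

Definition adj (E : {set {set V}}) : rel V := fun x y => [set x; y]%SET \in E.

(* A cycle has at least 3 vertices: as a [ucycle], an edge {x, y} yields the
   closed walk [:: x; y] of length 2. *)
Definition acyclic (E : {set {set V}}) : Prop :=
  forall c : seq V, (2 < size c)%N -> ~ ucycle (adj E) c.

Definition is_tree (E : {set {set V}}) : Prop :=
  [/\ simple_graph E, forall x y, connect (adj E) x y & acyclic E].

(* The root has no parent, so its children are all of its neighbours. *)
Definition root_children (T : {set {set V}} * V) : {set V} :=
  finset (adj T.1 T.2).

End Trees.

(* The label set [n] = {1, ..., n} is represented by 'I_n = {0, ..., n - 1};
   a rooted tree is a pair (edge set, root). *)
Definition uprooted (n : nat) (T : {set {set 'I_n}} * 'I_n) : Prop :=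
  is_tree T.1 /\ (forall v, v \in root_children T -> (v < T.2)%N).

Definition uprooted_count (n d : nat) : nat :=
  ncard [set T : {set {set 'I_n}} * 'I_n | uprooted T /\ #|root_children T| = d].

(* Main.v *)
(** Both sides are counted through one recursion.  Put F(t, m) = (t - m) t^(m-1),
    the number of forests on t vertices with t - m prescribed roots.  It satisfies
    F(t+1, m) = sum_j C(m, j) F(t, m - j).  For forests this is one step of a
    breadth-first search: take a root r out and turn its j children into roots.
    For exponent vectors that are at least u and have at most k - v entries that
    are at least v, for every v >= u, it is the choice of the j positions where
    the exponent is u.

    An exponent vector b lies in the boundary iff all b_i >= 1 and, for
    2 <= v <= n, at most n - v of the b_i are at least v; fixing the s positions
    of the exponents 1 leaves F(n-1, n-s) vectors.  In an uprooted tree the root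
    and its s - 1 children form an s-subset of [n] whose maximum is the root, and
    fixing it leaves F(n-1, n-s) forests. *)

Require Import Defs.
From mathcomp Require Import ssrbool fintype finset zify ring.

Set Implicit Arguments.
Unset Strict Implicit.
Unset Printing Implicit Defensive.

(** * The numbers F(t, m) and their binomial recursion *)

(* (t - m) t^(m-1), in a form that is right also for m = 0; the subtraction is
   truncated, so the value is 0 as soon as m >= t and m > 0. *)
Definition nforest (t m : nat) : nat := t ^ m - m * t ^ m.-1.

Lemma leq_mul_exp_pred (t m : nat) : m <= t -> m * t ^ m.-1 <= t ^ m.
Proof. by case: m => // m lemt; rewrite expnS leq_mul2r lemt orbT. Qed.

Lemma nforestD (t m : nat) : m <= t -> nforest t m + m * t ^ m.-1 = t ^ m.
Proof. by move=> lemt; rewrite subnK ?leq_mul_exp_pred. Qed.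

Lemma nforest_eq0 (t m : nat) : 0 < m -> t <= m -> nforest t m = 0.
Proof.
by case: m => // m _ letm; apply/eqP; rewrite subn_eq0 expnS leq_mul2r letm orbT.
Qed.

Lemma sum_bin_exp (t m : nat) :
  \sum_(i < m.+1) 'C(m, i) * t ^ (m - i) = t.+1 ^ m.
Proof.
by rewrite -(addn1 t) expnDn; apply: eq_bigr => i _; rewrite exp1n muln1.
Qed.

(** The derivative in t of [sum_bin_exp], obtained from (m - i) C(m, i) = m C(m - 1, i). *)
Lemma sum_bin_exp_deriv (t m : nat) :
  \sum_(i < m.+1) 'C(m, i) * ((m - i) * t ^ (m - i).-1) = m * t.+1 ^ m.-1.
Proof.
case: m => [|m]; first by rewrite big_ord1 !mul0n.
rewrite big_ord_recr /= subnn mul0n muln0 addn0 -sum_bin_exp big_distrr /=.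
apply: eq_bigr => i _.
by rewrite mulnA [_ * (_ - _)]mulnC -mul_bin_down -mulnA subSn // -ltnS.
Qed.

(** As [m <= t], no subtraction is truncated. Adding m (t+1)^(m-1) to both sides therefore leaves
    the difference of the two binomial sums above. *)
Lemma sum_bin_nforest (t m : nat) : m <= t ->
  \sum_(i < m.+1) 'C(m, i) * nforest t (m - i) = nforest t.+1 m.
Proof.
move=> lemt; apply: (@addIn (m * t.+1 ^ m.-1)).
rewrite nforestD ?(leqW lemt) // -sum_bin_exp_deriv -sum_bin_exp -big_split /=.
apply: eq_bigr => i _; rewrite -mulnDr nforestD //.
exact: leq_trans (leq_subr _ _) lemt.
Qed.

(** The case m = t + 1 of the recursion, where truncation matters: over the integers the sum would
    be 0 and its term i = 0 would be -t^t, but that term is truncated to 0. This yields the total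
    number of boundary monomials. *)
Lemma sum_bin_nforest_top (t : nat) :
  \sum_(i < t.+2) 'C(t.+1, i) * nforest t (t.+1 - i) = t ^ t.
Proof.
rewrite big_ord_recl subn0 nforest_eq0 // muln0 add0n.
have := sum_bin_exp t t.+1; have := sum_bin_exp_deriv t t.+1.
rewrite big_ord_recl [in X in _ -> X -> _]big_ord_recl !subn0 bin0 !mul1n /=.
set S1 := \sum_(i < _) _; set S2 := \sum_(i < _) _; set S3 := \sum_(i < _) _.
have <- : S3 + S1 = S2.
  rewrite -big_split; apply: eq_bigr => i _ /=.
  by rewrite -mulnDr nforestD // leq_subLR /bump /=; lia.
rewrite !expnS !mulSn => <-; lia.
Qed.

(** * Sums over subsets and counting by fibers *)

Section Counting.

Variable T : finType.
Implicit Types (D J R S : {set T}).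

Lemma sum_subset_card D (F : nat -> nat) :
  \sum_(J : {set T} | J \subset D) F #|J| =
    \sum_(i < #|D|.+1) 'C(#|D|, i) * F i.
Proof.
rewrite (partition_big (fun J => inord #|J| : 'I_#|D|.+1) predT) //=.
apply: eq_bigr => i _.
rewrite -(cards_draws D i) -[X in _ = X * _]sum1_card big_distrl /=.
rewrite (eq_bigl (fun J => J \in [set A : {set T} | A \subset D & #|A| == i])).
  by apply: eq_bigr => J; rewrite inE mul1n => /andP[_ /eqP->].
move=> J; rewrite !inE; case sJD: (J \subset D) => //=.
by rewrite -val_eqE /= inordK // ltnS subset_leq_card.
Qed.

Lemma sum_subset_nforest D (t : nat) : #|D| <= t ->
  \sum_(J : {set T} | J \subset D) nforest t #|D :\: J| = nforest t.+1 #|D|.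
Proof.
move=> leDt; rewrite -sum_bin_nforest //.
rewrite -(sum_subset_card D (fun i => nforest t (#|D| - i))).
by apply: eq_bigr => J sJD; rewrite cardsD (setIidPr sJD).
Qed.

Lemma card_fibers (U : finType) (A : {set U}) (g : U -> {set T}) D :
    (forall f, f \in A -> g f \subset D) ->
  #|A| = \sum_(J : {set T} | J \subset D) #|[set f in A | g f == J]|.
Proof.
move=> gA; rewrite -sum1_card (partition_big g (fun J => J \subset D)) //=.
by apply: eq_bigr => J _; rewrite -sum1_card; apply: eq_bigl => f; rewrite inE.
Qed.

(** * Exponent vectors with bounded tails *)

Section Parking.

Variable k : nat.
Implicit Type f : {ffun T -> 'I_k}.

(** For [#|D| = k - u] these are the parking functions on [D], shifted by [u]. Freezing [f] to [f0]
    off [D] makes a fiber of [parking] again a [parking]. *)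
Definition parking D (u : nat) f0 : {set {ffun T -> 'I_k}} :=
  [set f : {ffun T -> 'I_k} |
    [&& [forall (x | x \notin D), f x == f0 x], [forall x in D, u <= f x] &
        [forall v : 'I_k, (u <= v) ==> (#|[set x in D | v <= f x]| <= k - v)]]].

Lemma parkingP D u f0 f :
  reflect [/\ forall x, x \notin D -> f x = f0 x, forall x, x \in D -> u <= f x &
              forall v, u <= v -> #|[set x in D | v <= f x]| <= k - v]
          (f \in parking D u f0).
Proof.
rewrite inE; apply: (iffP and3P)=> [[/forall_inP p1 /forall_inP p2 /forallP p3]|].
  split=> // [x /p1/eqP //|v leuv].
  have [ltvk|lekv] := ltnP v k; first exact: implyP (p3 (Ordinal ltvk)) leuv.
  suff -> : [set x in D | v <= f x] = set0 by rewrite cards0.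
  apply/setP => x; rewrite !inE; apply/negP => /andP[_ levf].
  by have := leq_ltn_trans (leq_trans lekv levf) (ltn_ord (f x)); rewrite ltnn.
case=> p1 p2 p3; split; [apply/forall_inP => x /p1-> //| exact/forall_inP|].
by apply/forallP => v; apply/implyP; apply: p3.
Qed.

(** Positions with value [u] do not enter the tail conditions for [v > u], and the condition at
    [v = u] follows from [#|D| <= k - u]. *)
Lemma parking_fiber D J u (uk : u < k) f0 : J \subset D -> #|D| <= k - u ->
  [set f in parking D u f0 | [set x in D | f x == u :> nat] == J] =
    parking (D :\: J) u.+1 [ffun x => if x \in J then Ordinal uk else f0 x].
Proof.
move=> sJD leD; apply/setP => f; rewrite inE.
have tail v : u < v -> (forall x, x \in J -> f x = u :> nat) ->
    [set x in D | v <= f x] = [set x in D :\: J | v <= f x].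
  move=> ltuv fJ; apply/setP => x; rewrite !inE.
  by have [/fJ->|] := boolP (x \in J); rewrite // leqNgt ltuv andbF.
apply/andP/parkingP => [[/parkingP[p1 p2 p3] /eqP defJ]|[p1 p2 p3]].
  have fJ x : x \in J -> f x = u :> nat by rewrite -defJ inE => /andP[_ /eqP].
  split=> [x||v ltuv].
  - rewrite !inE negb_and negbK ffunE; case: ifP => [xJ _|_ /= /p1 //].
    by apply: val_inj; rewrite /= fJ.
  - move=> x; rewrite -defJ !inE => /andP[]; case xD: (x \in D) => //= neq _.
    by rewrite ltn_neqAle eq_sym neq p2.
  - by rewrite -tail // p3 // ltnW.
have fJ x : x \in J -> f x = u :> nat.
  by move=> xJ; rewrite p1 ?inE ?xJ // ffunE xJ.
have p2' x : x \in D -> u <= f x.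
  move=> xD; have [/fJ-> //|xJ] := boolP (x \in J).
  by apply/ltnW/p2; rewrite inE xJ.
split.
  apply/parkingP; split=> // [x xD|v].
    have xJ : x \notin J by apply: contra xD; apply: (subsetP sJD).
    by rewrite p1 ?inE ?xJ // ffunE (negPf xJ).
  rewrite leq_eqVlt => /predU1P[<-|ltuv]; last by rewrite tail // p3.
  rewrite (leq_trans _ leD) // subset_leq_card //.
  by apply/subsetP => x /setIdP[].
apply/eqP/setP => x; rewrite inE; have [xJ|xJ] := boolP (x \in J).
  by rewrite (subsetP sJD) // fJ // eqxx.
by case xD: (x \in D) => //=; rewrite gtn_eqF // p2 // inE xJ.
Qed.

(** Induction on [k - u], grouping by the set of positions with value [u]. If [#|D| > k - u], the
    condition at [v = u] fails for every [f], and F vanishes as well. *)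
Lemma card_parking D u f0 : u <= k -> #|parking D u f0| = nforest (k - u).+1 #|D|.
Proof.
move=> leuk; have [d] := ubnP (k - u); elim: d => // d IHd in D u f0 leuk *.
rewrite ltnS => led; have [leD|ltD] := leqP #|D| (k - u); last first.
  rewrite nforest_eq0 ?(leq_ltn_trans _ ltD) //.
  apply/eqP; rewrite cards_eq0; apply/set0Pn => -[f].
  case/parkingP=> _ p2 /(_ u (leqnn u)).
  suff -> : [set x in D | u <= f x] = D by rewrite leqNgt ltD.
  by apply/setP => x; rewrite !inE; case xD: (x \in D); rewrite // p2.
have [eq_uk|neq_uk] := eqVneq u k.
  rewrite eq_uk subnn in leD *; have D0 : D = set0.
    by apply/eqP; rewrite -cards_eq0 -leqn0.
  rewrite D0 cards0 (_ : parking _ _ _ = [set f0]) ?cards1 //.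
  apply/setP => f; rewrite in_set1; apply/parkingP/eqP => [[p1 _ _]|->].
    by apply/ffunP => x; rewrite p1 // inE.
  split=> // [x|v _]; first by rewrite inE.
  rewrite (_ : [set x in _ | _] = set0) ?cards0 //.
  by apply/setP => x; rewrite !inE.
have uk : u < k by rewrite ltn_neqAle neq_uk.
rewrite (@card_fibers _ _ (fun f => [set x in D | f x == u :> nat]) D);
  last first.
  by move=> f _; apply/subsetP => x; rewrite inE => /andP[].
rewrite -sum_subset_nforest //; apply: eq_bigr => J sJD.
rewrite (parking_fiber uk) // IHd //; first by rewrite -subSn // subSS.
by lia.
Qed.

End Parking.

(** * Forests with prescribed roots *)

Implicit Type p : {ffun T -> T}.

(* The last condition says that iterating [p] leads from every point of [D] out of
   [D]; prescribing [p0] off [D] makes a fiber of [forests] again a [forests]. *)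
Definition forests D R p0 : {set {ffun T -> T}} :=
  [set p : {ffun T -> T} |
    [&& [forall (x | x \notin D), p x == p0 x], [forall x in D, p x \in D :|: R] &
        [forall S : {set T}, (S \subset D) && (S != set0) ==>
           [exists x in S, p x \notin S]]]].

Lemma forestsP D R p0 (p : {ffun T -> T}) :
  reflect [/\ forall x, x \notin D -> p x = p0 x,
              forall x, x \in D -> p x \in D :|: R &
              forall S, S \subset D -> S != set0 ->
                exists2 x, x \in S & p x \notin S]
          (p \in forests D R p0).
Proof.
rewrite inE.
apply: (iffP and3P) => [[/forall_inP p1 /forall_inP p2 /forallP p3]|[p1 p2 p3]].
  split=> // [x /p1/eqP //|S sSD S0].
  by apply/exists_inP; apply: (implyP (p3 S)); rewrite sSD.
split; [apply/forall_inP => x /p1-> //|exact/forall_inP|].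
apply/forallP => S; apply/implyP => /andP[sSD /p3-/(_ sSD) ?].
by apply/exists_inP.
Qed.

(** The children [J] of the root [r] become roots in its place. *)
Lemma forests_fiber D R J r p0 : r \in R -> [disjoint D & R] -> J \subset D ->
  [set p in forests D R p0 | [set x in D | p x == r] == J] =
    forests (D :\: J) (R :\ r :|: J) [ffun x => if x \in J then r else p0 x].
Proof.
move=> rR dDR sJD; have rD : r \notin D by rewrite (disjointFl dDR).
apply/setP => p; rewrite inE.
apply/andP/forestsP => [[/forestsP[p1 p2 p3] /eqP defJ]|[p1 p2 p3]].
  have pJ x : x \in J -> p x = r by rewrite -defJ inE => /andP[_ /eqP].
  split=> [x|x|S sS].
  - rewrite !inE negb_and negbK ffunE; case: ifP => [xJ _|_ /= /p1 //].
    by rewrite pJ.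
  - rewrite -{1}defJ !inE => /andP[]; case xD: (x \in D) => //= neq _.
    have := p2 x xD; rewrite !inE neq /=.
    by case: (p x \in J); rewrite ?orbT //= orbF.
  - by apply: p3; apply: subset_trans sS (subsetDl _ _).
have pJ x : x \in J -> p x = r by move=> xJ; rewrite p1 ?inE ?xJ // ffunE xJ.
split.
  apply/forestsP; split=> [x xD|x xD|S sSD S0].
  - have xJ : x \notin J by apply: contra xD; apply: (subsetP sJD).
    by rewrite p1 ?inE ?xJ // ffunE (negPf xJ).
  - have [/pJ->|xJ] := boolP (x \in J); first by rewrite inE rR orbT.
    have := p2 x; rewrite !inE xJ xD => /(_ isT).
    case/orP=> [/andP[_ ->] //|/orP[/andP[_ ->]|/(subsetP sJD)->] //].
    by rewrite orbT.
  (* A set [S] that meets [J] is left at any point of [J], which [p] sends to [r], outside [D]. *)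
  - have [sSJ|/subsetPn[x xS]] := boolP (S \subset D :\: J); first exact: p3.
    rewrite inE (subsetP sSD) // andbT negbK => xJ; exists x => //.
    by rewrite pJ //; apply: contra rD; apply: (subsetP sSD).
apply/eqP/setP => x; rewrite inE; have [xJ|xJ] := boolP (x \in J).
  by rewrite (subsetP sJD) // pJ // eqxx.
case xD: (x \in D) => //=; apply/negP => /eqP pxr.
have := p2 x; rewrite !inE xJ xD pxr (negPf rD) eqxx andbF /= => /(_ isT).
by move/(subsetP sJD); apply/negP.
Qed.

(** Induction on the number of vertices, which drops by one when a root is taken out. Without roots,
    a nonempty [D] would be mapped into itself, so there is no forest. *)
Lemma card_forests D R p0 : [disjoint D & R] ->
  #|forests D R p0| = nforest (#|D| + #|R|) #|D|.
Proof.
move=> dDR; have [d] := ubnP (#|D| + #|R|); elim: d => // d IHd in D R p0 dDR *.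
rewrite ltnS => led; have [R0|/set0Pn[r rR]] := eqVneq R set0.
  rewrite R0 cards0 addn0; have [D0|Dn0] := eqVneq D set0.
    rewrite D0 cards0 (_ : forests _ _ _ = [set p0]) ?cards1 //.
    apply/setP => p; rewrite in_set1; apply/forestsP/eqP => [[p1 _ _]|->].
      by apply/ffunP => x; rewrite p1 // inE.
    by split=> // [x|S]; rewrite ?inE // subset0 => ->.
  rewrite nforest_eq0 ?card_gt0 //; apply/eqP; rewrite cards_eq0.
  apply/set0Pn => -[p /forestsP[_ p2 p3]].
  have [x xD] := p3 D (subxx D) Dn0.
  by have := p2 x xD; rewrite setU0 => ->.
have [t defR] : exists t, #|R| = t.+1.
  by exists #|R|.-1; rewrite prednK //; apply/card_gt0P; exists r.
rewrite (@card_fibers _ _ (fun p => [set x in D | p x == r]) D); last first.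
  by move=> f _; apply/subsetP => x; rewrite inE => /andP[].
rewrite defR addnS -sum_subset_nforest ?leq_addr //; apply: eq_bigr => J sJD.
have dJR : [disjoint J & R] := disjointWl sJD dDR.
have cR : #|R :\ r :|: J| = t + #|J|.
  rewrite cardsU (_ : _ :&: _ = set0) ?cards0 ?subn0; last first.
    apply/eqP; rewrite setI_eq0 disjoint_sym.
    by apply: disjointWr dJR; apply: subsetDl.
  by have := cardsD1 r R; rewrite rR defR add1n => -[->].
have cD : #|D :\: J| + (t + #|J|) = #|D| + t.
  rewrite cardsD (setIidPr sJD).
  have := subset_leq_card sJD; lia.
rewrite forests_fiber // IHd ?cR ?cD //; last by lia.
rewrite disjoint_sym disjoints_subset; apply/subsetP => x; rewrite !inE.
by case: (x \in J) => //=; rewrite orbF => /andP[_ /(disjointFl dDR)->].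
Qed.

End Counting.

(** * Rooted trees as parent functions *)

Section ParentFunctions.

Variable V : finType.
Implicit Types (x y z r : V) (p q : {ffun V -> V}) (S J : {set V}).
Implicit Type E : {set {set V}}.

Lemma eq_set2 x y z t :
  reflect (x = z /\ y = t \/ x = t /\ y = z) ([set x; y] == [set z; t]).
Proof.
apply: (iffP eqP) => [e|[[-> ->]|[-> ->]]]; rewrite 1?setUC //.
have : x \in [set z; t] by rewrite -e set21.
have : y \in [set z; t] by rewrite -e set22.
have : z \in [set x; y] by rewrite e set21.
have : t \in [set x; y] by rewrite e set22.
by do 4!case/set2P => ?; subst; auto.
Qed.

Lemma adj_sym E : symmetric (adj E).
Proof. by move=> x y; rewrite /adj setUC. Qed.

(** The parent functions of the trees with root [r]; prescribing the identity off [[set~ r]] makes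
    the root its own parent. *)
Definition parents r : {set {ffun V -> V}} :=
  forests [set~ r] [set r] [ffun x => x].

Lemma parentsP r p :
  reflect (p r = r /\
           forall S, r \notin S -> S != set0 -> exists2 x, x \in S & p x \notin S)
          (p \in parents r).
Proof.
have sub S : (S \subset [set~ r]) = (r \notin S).
  by rewrite -disjoints_subset disjoint_sym disjoints1.
apply: (iffP (forestsP _ _ _ _)) => [[p1 _ p3]|[pr p3]].
  split=> [|S rS S0]; first by rewrite p1 ?ffunE // !inE eqxx.
  by apply: p3; rewrite ?sub.
split=> [x|x _|S]; last by rewrite sub; apply: p3.
  by rewrite !inE negbK => /eqP->; rewrite ffunE.
by rewrite !inE orNb.
Qed.

Definition tree_edges r p : {set {set V}} := [set [set x; p x] | x in [set~ r]].

Lemma adj_tree_edges r p x y :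
  adj (tree_edges r p) x y = (x != r) && (p x == y) || (y != r) && (p y == x).
Proof.
apply/imsetP/idP => [[z]|].
  rewrite !inE => zr /eqP/eq_set2[[-> ->]|[-> ->]]; rewrite zr eqxx ?orbT //.
case/orP=> /andP[zr /eqP<-]; [exists x|exists y]; rewrite ?inE //.
by rewrite setUC.
Qed.

Section Fixed.

Variables (r : V) (p : {ffun V -> V}).
Hypothesis pP : p \in parents r.

Lemma parent_neq x : x != r -> p x != x.
Proof.
have [_ p3] := parentsP r p pP; move=> xr.
have [||y /set1P->] := p3 [set x]; last by rewrite inE.
  by rewrite inE eq_sym.
by apply/set0Pn; exists x; rewrite inE.
Qed.

(** If some vertices were not connected to [r], one of them would have its parent outside their set,
    hence a parent connected to [r]. *)
Lemma connect_tree_edges x : connect (adj (tree_edges r p)) x r.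
Proof.
have [_ p3] := parentsP r p pP.
pose S := [set z | ~~ connect (adj (tree_edges r p)) z r].
have [S0|Sn0] := eqVneq S set0.
  by apply/negPn; have := in_set0 x; rewrite -S0 inE => ->.
have [|//|z] := p3 S; first by rewrite inE connect0.
rewrite !inE negbK => nzr pzr; case/negP: (nzr).
apply: connect_trans pzr; apply: connect1; rewrite adj_tree_edges eqxx andbT.
by case: eqP nzr => // ->; rewrite connect0.
Qed.

Lemma connect2_tree_edges x y : connect (adj (tree_edges r p)) x y.
Proof.
apply: connect_trans (connect_tree_edges x) _.
by rewrite sym_connect_sym ?connect_tree_edges //; apply: adj_sym.
Qed.

(* A vertex of the cycle which is the parent of no other vertex of the cycle has
   two distinct neighbours on it, and both must be its parent. *)
Lemma acyclic_tree_edges : acyclic (tree_edges r p).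
Proof.
have [pr p3] := parentsP r p pP; move=> c c3 /andP[cc uc].
pose S := [set x in c].
pose S' := [set x in S | (x != r) && (p x \in S)].
have [x xc xN] : exists2 x, x \in c & forall y, y \in c -> y != r -> p y != x.
  (* If there were no such vertex, [p] would map [S'] onto [S]; counting gives [S' = S], so the
     cycle avoids [r] and is closed under [p], against [p3]. *)
  have [sS|/subsetPn[x]] := boolP (S \subset p @: S'); last first.
    rewrite inE => xc xN; exists x => // y yc yr; apply: contra xN => /eqP pyx.
    by apply/imsetP; exists y; rewrite // !inE yc yr pyx.
  have sS'S : S' \subset S by apply/subsetP => x; rewrite inE => /andP[].
  have eS : S' = S.
    apply/eqP; rewrite eqEcard sS'S /=.
    exact: leq_trans (subset_leq_card sS) (leq_imset_card _ _).
  have [||x xS] := p3 S.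
  - by rewrite -eS inE eqxx andbF.
  - apply/set0Pn; rewrite /S; case: (c) c3 => // x c' _.
    by exists x; rewrite !inE eqxx.
  - by move: xS; rewrite -{1}eS inE => /and3P[_ _ ->].
have [i c' rotc] := rot_to xc.
have mem_c y : (y \in x :: c') = (y \in c) by rewrite -rotc mem_rot.
move: cc uc c3; rewrite -(rot_cycle i) -(rot_uniq i) -(size_rot i) rotc.
have nbr y : y \in c -> adj (tree_edges r p) x y -> y = p x.
  move=> yc; rewrite adj_tree_edges => /orP[/andP[_ /eqP//]|/andP[yr /eqP pyx]].
  by have := xN y yc yr; rewrite pyx eqxx.
case: c' rotc mem_c => [|y [|z c']] // _ mem_c /=.
rewrite rcons_path => /and4P[xy _ _ zx] /and4P[_ yN _ _] _.
have eqy : y = p x by apply: nbr; rewrite // -mem_c !inE eqxx orbT.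
suff eql : last z c' = p x by move: yN; rewrite eqy -eql mem_last.
apply: nbr; last by rewrite adj_sym.
by rewrite -mem_c !in_cons -in_cons mem_last !orbT.
Qed.

Lemma is_tree_edges : is_tree (tree_edges r p).
Proof.
split; [|exact: connect2_tree_edges|exact: acyclic_tree_edges].
move=> e /imsetP[x]; rewrite !inE => xr ->.
by rewrite cards2 eq_sym parent_neq.
Qed.

Lemma root_children_tree_edges :
  root_children (tree_edges r p, r) = [set x in [set~ r] | p x == r].
Proof.
by apply/setP => x; rewrite [LHS]inE /= adj_tree_edges !inE eqxx.
Qed.

End Fixed.

(** Leave the set where [p] and [q] differ at [x]. The common edge between [x] and [p x] forces
    [q (p x) = x], and [p] agrees with [q] at [p x], so the pair of [x] and [p x] is closed under
    [p]. *)
Lemma tree_edges_inj r : {in parents r &, injective (tree_edges r)}.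
Proof.
move=> p q pP qP eqE.
have [pr p3] := parentsP r p pP; have [qr q3] := parentsP r q qP.
pose S := [set x | p x != q x].
have [S0|Sn0] := eqVneq S set0.
  by apply/ffunP => x; apply/eqP/negPn; have := in_set0 x; rewrite -S0 inE => ->.
have [|//|x] := p3 S; first by rewrite inE pr qr eqxx.
rewrite !inE negbK => neq /eqP ppx.
have xr : x != r by apply: contraNneq neq => ->; rewrite pr qr.
have := adj_tree_edges r q x (p x); rewrite -eqE adj_tree_edges xr eqxx /=.
rewrite eq_sym (negPf neq) /= -ppx => /esym/andP[pxr /eqP ppxx].
have [||z] := p3 [set x; p x].
- by rewrite !inE !(eq_sym r) negb_or xr.
- by apply/set0Pn; exists x; rewrite !inE eqxx.
- by case/set2P=> ->; rewrite ?ppxx !inE eqxx ?orbT.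
Qed.

(** The parent is a neighbour closer to [r]. A vertex of [S] at minimal distance [h] then has its
    parent outside [S]. *)
Lemma parents_of_connected E r : (forall x, connect (adj E) x r) ->
  exists2 p, p \in parents r & forall x, x != r -> adj E x (p x).
Proof.
move=> conE.
pose reach x k :=
  `[< exists s, [/\ path (adj E) x s, last x s = r & size s = k] >].
have ex_h x : exists k, reach x k.
  have /connectP[s ps ls] := conE x; exists (size s); apply/asboolP.
  by exists s; split.
pose h x := ex_minn (ex_h x).
have hP x : x != r -> exists y, adj E x y && (h y < h x).
  move=> xr; rewrite {2}/h; case: ex_minnP => k /asboolP[[|y s] [/=]].
    by move=> _ xr'; rewrite xr' eqxx in xr.
  case/andP=> xy ps ls <- _; exists y; rewrite xy /= ltnS /h.
  by case: ex_minnP => m _; apply; apply/asboolP; exists s.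
pose p := [ffun x =>
  if [pick y | adj E x y && (h y < h x)] is Some y then y else x].
have pE x : x != r -> adj E x (p x) && (h (p x) < h x).
  move=> xr; rewrite ffunE; case: pickP => [y //|no].
  by have [y] := hP x xr; rewrite no.
exists p; last by move=> x /pE/andP[].
apply/parentsP; split.
  (* At the root [h] is 0, so no neighbour is closer and the default [p r = r] applies. *)
  rewrite ffunE; case: pickP => // y /andP[_]; rewrite {2}/h.
  have r0 : reach r 0 by apply/asboolP; exists [::].
  by case: ex_minnP => k _ /(_ 0 r0); rewrite leqn0 => /eqP->.
move=> S rS /set0Pn[x0 x0S].
case: (arg_minnP h x0S) => x xS xmin; exists x => //.
have xr : x != r by apply: contraNneq rS => <-.
by apply/negP => /xmin; rewrite leqNgt; case/andP: (pE x xr) => _ ->.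
Qed.

(** The parent function found above spans a tree inside [E]; any further edge of [E] would close a
    simple path of that tree to a cycle. *)
Lemma tree_edges_onto E r : is_tree E ->
  exists2 p, p \in parents r & tree_edges r p = E.
Proof.
move=> [sE cE aE]; have [p pP pE] := parents_of_connected (cE^~ r).
have sub x y : adj (tree_edges r p) x y -> adj E x y.
  rewrite adj_tree_edges => /orP[]/andP[zr /eqP<-]; first exact: pE.
  by rewrite adj_sym pE.
exists p => //; apply/eqP; rewrite eqEsubset; apply/andP; split.
  by apply/subsetP => e /imsetP[x]; rewrite !inE => xr ->; apply: pE.
apply/subsetP => e eE; have /eqP/cards2P[x [y [neq_xy def_e]]] := sE e eE.
rewrite def_e in eE *; apply: contraT => nxy.
have /connectP[s ps ls] := connect2_tree_edges pP x y.
case/shortenP: ps ls => s' ps' us' _ ls.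
(* Length 0 contradicts that [x] and [y] differ, length 1 that the edge is not in the tree;
   otherwise the cycle has at least 3 vertices. *)
case: s' => [|z [|t s']] in ps' us' ls.
- by rewrite ls eqxx in neq_xy.
- by move: ps' nxy; rewrite /= andbT /adj -[z]/(last x [:: z]) -ls => ->.
case: (aE [:: x, z, t & s']) => //; rewrite /ucycle us' andbT.
rewrite /cycle rcons_path -ls (sub_path sub) //= adj_sym.
exact: eE.
Qed.

(** Taking out the only root [r] leaves a forest on the other vertices, whose roots are [J]. *)
Lemma card_parents_fiber r J : r \notin J ->
  #|[set p in parents r | [set x in [set~ r] | p x == r] == J]| =
    nforest #|V|.-1 (#|V|.-1 - #|J|).
Proof.
move=> rJ; have sJ : J \subset [set~ r].
  by rewrite -disjoints_subset disjoint_sym disjoints1.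
rewrite forests_fiber ?set11 // ?card_forests.
- rewrite setDv set0U cardsD (setIidPr sJ) cardsC1 subnK //.
  by rewrite -(cardsC1 r) subset_leq_card.
- by rewrite setDv set0U disjoint_sym disjoints_subset setCD subsetUr.
- by rewrite disjoints_subset subxx.
Qed.

End ParentFunctions.

(** * Transfer to [ncard], and the count of uprooted trees *)

Lemma ncard_imset (U : finType) (T : choiceType) (f : U -> T) (B : {set U})
    (A : set T) : {in B &, injective f} ->
  (forall t, A t <-> exists2 u, u \in B & f u = t) -> ncard A = #|B|.
Proof.
move=> injf defA; rewrite /ncard.
suff -> : A = [set` [fset f u | u in B]%fset]%classic.
  by rewrite set_fsetK card_in_imfset // cardE.
apply/seteqP; split=> t /=.
  by move=> /defA[u uB <-]; apply/imfsetP; exists u.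
by case/imfsetP=> u uB ->; apply/defA; exists u.
Qed.

(** Sorts the (d+1)-subsets of ['I_n] by their maximum r. *)
Lemma sum_bin_ord (n d : nat) : \sum_(r < n) 'C(r, d) = 'C(n, d.+1).
Proof.
by elim: n => [|n IHn]; rewrite ?big_ord0 // big_ord_recr /= IHn binS addnC.
Qed.

Section Uprooted.

Variable n : nat.
Implicit Types (r : 'I_n) (J : {set 'I_n}).

Definition below r : {set 'I_n} := [set v : 'I_n | v < r].

Lemma card_below r : #|below r| = r.
Proof.
rewrite cardsE -sum1_card -(big_ord_widen _ (fun _ => 1)) ?(ltnW (ltn_ord r)) //.
by rewrite sum1_card card_ord.
Qed.

Definition children r (p : {ffun 'I_n -> 'I_n}) : {set 'I_n} :=
  [set x in [set~ r] | p x == r].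

Definition uprooted_parents (d : nat) : {set 'I_n * {ffun 'I_n -> 'I_n}} :=
  [set rp : 'I_n * {ffun 'I_n -> 'I_n} | [&& rp.2 \in parents rp.1,
     children rp.1 rp.2 \subset below rp.1 & #|children rp.1 rp.2| == d]].

(** Group by the pair of the root and its set of children: all fibers have the same size, and the
    pairs correspond to the (d+1)-subsets of ['I_n]. *)
Lemma card_uprooted_parents d :
  #|uprooted_parents d| = 'C(n, d.+1) * nforest n.-1 (n.-1 - d).
Proof.
pose F (rp : 'I_n * {ffun 'I_n -> 'I_n}) := (rp.1, children rp.1 rp.2).
pose Q (rJ : 'I_n * {set 'I_n}) := (rJ.2 \subset below rJ.1) && (#|rJ.2| == d).
rewrite -sum1_card (partition_big F Q) /=; last first.
  by move=> rp; rewrite inE => /and3P[_ ? ?]; apply/andP.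
transitivity (\sum_(rJ | Q rJ) nforest n.-1 (n.-1 - d)).
  apply: eq_bigr => -[r J] /andP[/= sJ /eqP cJ].
  have rJ : r \notin J.
    by apply/negP => /(subsetP sJ); rewrite inE ltnn.
  have := card_parents_fiber rJ; rewrite card_ord cJ => <-; rewrite sum1dep_card.
  have pair_inj : injective (pair r : {ffun 'I_n -> 'I_n} -> _) by move=> p q [].
  rewrite -[RHS](card_imset _ pair_inj).
  apply: eq_card => -[r' p]; rewrite inE.
  apply/andP/imsetP => [[]|[q]].
    rewrite inE => /and3P[/= pP _ _] /eqP[eqr defJ]; rewrite eqr in pP defJ *.
    by exists p; rewrite // inE pP /= -defJ.
  rewrite inE => /andP[qP /eqP defJ] [-> ->].
  by rewrite inE /F /= /children qP defJ sJ cJ !eqxx.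
rewrite (eq_bigl (fun rJ => predT rJ.1 && Q (rJ.1, rJ.2))); last by case.
rewrite -(pair_big_dep predT (fun r J => Q (r, J))
  (fun _ _ => nforest n.-1 (n.-1 - d))) /=.
rewrite -sum_bin_ord big_distrl /=; apply: eq_bigr => r _.
rewrite sum_nat_const -(card_below r) -cards_draws; congr (_ * _).
by apply: eq_card => J; rewrite inE.
Qed.

Lemma uprooted_countE d :
  uprooted_count n d = 'C(n, d.+1) * nforest n.-1 (n.-1 - d).
Proof.
rewrite -card_uprooted_parents /uprooted_count.
apply: (ncard_imset (f := fun rp => (tree_edges rp.1 rp.2, rp.1))).
  move=> [r p] [r' q] /setIdP[/= pP _] /setIdP[/= qP _] [/= + eqr].
  by rewrite -eqr in qP * => /tree_edges_inj->.
move=> [E r]; split=> [[[/= tE ltr] cE]|[[r' p]]].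
  have [p pP defE] := tree_edges_onto r tE; exists (r, p); rewrite /= ?defE //.
  rewrite inE /= pP -[children r p]root_children_tree_edges defE cE eqxx andbT.
  by apply/subsetP => v /ltr; rewrite inE.
rewrite inE /= => /and3P[pP sJ /eqP cJ] [<- <-].
split; last by rewrite /= root_children_tree_edges.
split=> [|v]; first exact: is_tree_edges.
by rewrite /= root_children_tree_edges => /(subsetP sJ); rewrite inE.
Qed.

End Uprooted.

(** * Boundary monomials and their exponent vectors *)

Section StandardMonomials.

Variables (K : fieldType) (n : nat).
Implicit Types (m : 'X_{1..n}) (sigma : {set 'I_n}).

Definition gen_mnm sigma : 'X_{1..n} :=
  [multinom if i \in sigma then n - #|sigma| + 1 else 0 | i < n].

Lemma m_genE sigma : m_gen K sigma = 'X_[gen_mnm sigma].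
Proof.
rewrite mpolyXE_id /m_gen big_mkcond; apply: eq_bigr => i _.
by rewrite mnmE; case: (i \in sigma); rewrite ?expr0.
Qed.

(** A monomial lies in the ideal iff a generator divides it: in a combination equal to ['X_[m]],
    some summand has a nonzero coefficient at [m], and all monomials of that summand are multiples
    of its generator. *)
Lemma M_idealP k m : M_ideal K n k 'X_[m] <->
  exists2 sigma : {set 'I_n}, 1 <= #|sigma| <= k.+1 &
    forall i, i \in sigma -> n - #|sigma| < m i.
Proof.
have lepP sigma : (forall i, i \in sigma -> n - #|sigma| < m i) <->
    (gen_mnm sigma <= m)%MM.
  split=> [lt_m|/mnm_lepP le_m i iS].
    by apply/mnm_lepP => i; rewrite mnmE addn1; case: ifP => // /lt_m.
  by have := le_m i; rewrite mnmE iS addn1.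
split=> [[c def_m]|[sigma cS /lepP le_m]].
  have [sigma /andP[cS]|no] := pickP (fun sigma : {set 'I_n} =>
    (1 <= #|sigma| <= k.+1) && ((c sigma * m_gen K sigma)@_m != 0)%R).
    rewrite m_genE -mcoeff_msupp (perm_mem (msuppMX _ _)) => /mapP[m' _ def].
    exists sigma => //; apply/lepP; rewrite def.
    by apply/mnm_lepP => i; rewrite mnmDE leq_addr.
  have /eqP := congr1 (mcoeff m) def_m.
  rewrite mcoeffX eqxx GRing.raddf_sum /= big1 ?GRing.oner_eq0 // => sigma cS.
  by apply/eqP/negPn; have := no sigma; rewrite cS => /= ->.
exists (fun tau => if tau == sigma then 'X_[m - gen_mnm sigma]%MM else 0%R).
rewrite (bigD1 sigma) //= eqxx big1 ?GRing.addr0 => [|tau /andP[_ /negPf->]].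
  by rewrite m_genE -mpolyXD submK.
by rewrite GRing.mul0r.
Qed.

(** The larger ideal has one more generator, the product of all variables, so it must divide the
    monomial. A generator for a set of size c = n - v + 1 divides it iff all exponents on that set
    are at least v. *)
Lemma bd_stanP m : 2 <= n -> bd_stan K n m <->
  (forall i, 0 < m i) /\
  (forall v, 2 <= v <= n -> #|[set i | v <= m i]| <= n - v).
Proof.
move=> n2; have eqn2 : (n - 2).+1 = n.-1 by lia.
have eqn1 : (n - 1).+1 = n by lia.
split=> [[st /contrapT/M_idealP[tau]]|[m_gt0 m_le]].
  rewrite eqn1 => /andP[tau1 taun] mtau.
  have nst sigma : 1 <= #|sigma| <= n.-1 ->
      ~ forall i, i \in sigma -> n - #|sigma| < m i.
    by move=> cS lt_m; apply: st; apply/M_idealP; exists sigma; rewrite ?eqn2.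
  have tauT : tau = setT.
    apply/eqP; rewrite eqEcard subsetT cardsT card_ord /= leqNgt.
    apply/negP => lt_tau.
    by apply: (nst tau) => //; rewrite tau1 -ltnS prednK // ltnW.
  split=> [i|v /andP[v2 vn]].
    by have := mtau i; rewrite tauT cardsT card_ord subnn inE; apply.
  rewrite leqNgt; apply/negP; set sigma := [set i | _] => lt_sigma.
  have [s_le|s_gt] := leqP #|sigma| n.-1.
    apply: (nst sigma) => [|i].
      by rewrite s_le andbT (leq_ltn_trans _ lt_sigma).
    rewrite inE; apply: leq_trans.
    by rewrite ltn_subCl // (leq_trans s_le) ?leq_pred.
  have sT : sigma = setT.
    apply/eqP; rewrite eqEcard subsetT cardsT card_ord.
    by apply: leq_trans s_gt; apply: leqSpred.
  (* The full set gives no generator of the smaller ideal, but as all exponents are at least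
     [v >= 2], any set of n - 1 indices serves; the index left out is arbitrary. *)
  apply: (nst [set~ Ordinal n2]) => [|i _]; rewrite cardsC1 card_ord.
    by lia.
  have : v <= m i by have := in_setT i; rewrite -sT inE.
  by lia.
split=> [/M_idealP[sigma]|]; last first.
  move=> st; apply: st.
  apply/M_idealP; exists setT => [|i _]; rewrite cardsT card_ord; first by lia.
  by rewrite subnn.
rewrite eqn2 => s1n lt_m.
have arith c : 1 <= c <= n.-1 -> 2 <= (n - c).+1 <= n /\ ~~ (c <= n - (n - c).+1).
  by lia.
have [/m_le le_c /negP[]] := arith _ s1n.
by apply: leq_trans le_c; apply/subset_leq_card/subsetP => i /lt_m; rewrite inE.
Qed.

(** The condition at [v = n] in [bd_stanP] says that all exponents are below [n], which the codomain
    ['I_n] encodes. *)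
Definition bd_exponents : {set {ffun 'I_n -> 'I_n}} :=
  [set b : {ffun 'I_n -> 'I_n} | [forall i, 0 < b i] &&
     [forall v : 'I_n, (2 <= v) ==> (#|[set i | v <= b i]| <= n - v)]].

Lemma bd_exponentsP (b : {ffun 'I_n -> 'I_n}) :
  reflect ((forall i, 0 < b i) /\
           (forall v, 2 <= v <= n -> #|[set i | v <= b i]| <= n - v))
          (b \in bd_exponents).
Proof.
rewrite inE; apply: (iffP andP) => [[/forallP b0 /forallP bv]|[b0 bv]].
  split=> // v /andP[v2 vn]; have [ltvn|lenv] := ltnP v n.
    exact: implyP (bv (Ordinal ltvn)) v2.
  rewrite (_ : [set i | _] = set0) ?cards0 //; apply/setP => i; rewrite !inE.
  by apply/negbTE; rewrite -ltnNge (leq_trans (ltn_ord _) lenv).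
split; first exact/forallP.
by apply/forallP => v; apply/implyP => v2; apply: bv; rewrite v2 ltnW.
Qed.

Lemma bd_exponents_fiber (n1 : 1 < n) (J : {set 'I_n}) :
  [set b in bd_exponents | [set i | b i == 1 :> nat] == J] =
    parking (~: J) 2 [ffun => Ordinal n1].
Proof.
apply/setP => b; rewrite inE.
have tail v : 1 < v -> (forall i, i \in J -> b i = 1 :> nat) ->
    [set i | v <= b i] = [set i in ~: J | v <= b i].
  move=> v1 bJ; apply/setP => i; rewrite !inE.
  by have [/bJ->|] := boolP (i \in J); rewrite // leqNgt v1.
apply/andP/parkingP => [[/bd_exponentsP[b0 bv] /eqP defJ]|[b1 b2 bv]].
  have bJ i : i \in J -> b i = 1 :> nat by rewrite -defJ inE => /eqP.
  split=> [i|i|v v2].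
  - by rewrite inE negbK ffunE => /bJ bi; apply: val_inj.
  - by rewrite -defJ !inE ltn_neqAle eq_sym b0 andbT.
  - rewrite -tail //; have [vn|nv] := leqP v n; first by rewrite bv ?v2.
    rewrite (_ : [set i | _] = set0) ?cards0 //; apply/setP => i; rewrite !inE.
    by apply/negbTE; rewrite -ltnNge (ltn_trans (ltn_ord _) nv).
have bJ i : i \in J -> b i = 1 :> nat by move=> iJ; rewrite b1 ?inE ?iJ // ffunE.
split.
  apply/bd_exponentsP; split=> [i|v /andP[v2 _]]; last by rewrite tail ?bv.
  by have [/bJ-> //|iJ] := boolP (i \in J); rewrite ltnW // b2 ?inE.
apply/eqP/setP => i; rewrite inE.
have [/bJ->|iJ] := boolP (i \in J); first exact: eqxx.
by rewrite gtn_eqF // b2 // inE.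
Qed.

Lemma card_bd_exponents_fiber (J : {set 'I_n}) : 1 < n ->
  #|[set b in bd_exponents | [set i | b i == 1 :> nat] == J]| =
    nforest n.-1 (n - #|J|).
Proof.
move=> n1; rewrite bd_exponents_fiber card_parking // cardsCs setCK card_ord.
by congr nforest; lia.
Qed.

Definition mnm_of_ffun (b : {ffun 'I_n -> 'I_n}) : 'X_{1..n} :=
  [multinom (b i : nat) | i < n].

Lemma mnm_of_ffun_inj : injective mnm_of_ffun.
Proof.
move=> b b' /mnmP eqb; apply/ffunP => i; apply: val_inj.
by have := eqb i; rewrite !mnmE.
Qed.

Lemma bd_stan_ffun m : 2 <= n ->
  bd_stan K n m <-> exists2 b, b \in bd_exponents & mnm_of_ffun b = m.
Proof.
move=> n2; split=> [/(bd_stanP _ n2)[m0 mv]|[b /bd_exponentsP[b0 bv] <-]].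
  have ltm i : m i < n.
    have := mv n; rewrite n2 subnn leqn0 leqnn cards_eq0.
    move=> /(_ isT)/eqP/setP/(_ i).
    by rewrite !inE ltnNge => ->.
  pose b := [ffun i => Ordinal (ltm i)].
  have bE i : b i = m i :> nat by rewrite ffunE.
  exists b; last by apply/mnmP => i; rewrite mnmE bE.
  apply/bd_exponentsP; split=> [i|v /mv]; first by rewrite bE.
  by congr (_ <= _); apply: eq_card => i; rewrite !inE bE.
apply/bd_stanP => //; split=> [i|v /bv]; first by rewrite mnmE.
by congr (_ <= _); apply: eq_card => i; rewrite !inE mnmE.
Qed.

(** Summing over all sets of positions of the exponent 1 gives the sum in [sum_bin_nforest_top] for
    t = n - 1. *)
Lemma card_bd_stan : 2 <= n -> ncard (bd_stan K n) = n.-1 ^ n.-1.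
Proof.
move=> n2; rewrite (@ncard_imset _ _ mnm_of_ffun bd_exponents) => [||m].
- pose ones (b : {ffun 'I_n -> 'I_n}) := [set i | b i == 1 :> nat].
  rewrite (@card_fibers _ _ _ ones setT) => [|b _]; last exact: subsetT.
  under eq_bigr => J _ do rewrite card_bd_exponents_fiber //.
  rewrite (@sum_subset_card _ setT (fun j => nforest n.-1 (n - j))).
  rewrite cardsT card_ord.
  by case: n n2 => // n' _; apply: sum_bin_nforest_top.
- by move=> b b' _ _; apply: mnm_of_ffun_inj.
- exact: bd_stan_ffun.
Qed.

Lemma O_countE s : 2 <= n -> O_count K n s = 'C(n, s) * nforest n.-1 (n - s).
Proof.
move=> n2; pose g (b : {ffun 'I_n -> 'I_n}) := [set i | b i == 1 :> nat].
rewrite /O_count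
  (@ncard_imset _ _ mnm_of_ffun [set b in bd_exponents | #|g b| == s]).
- rewrite -[n in 'C(n, s)]card_ord -(card_draws 'I_n s).
  rewrite -[X in _ = X * _]sum1_card big_distrl /=.
  pose Q J := J \in [set A : {set 'I_n} | #|A| == s].
  rewrite -sum1_card (partition_big g Q) /= => [|b]; last first.
    by rewrite /Q !inE => /andP[].
  apply: eq_bigr => J; rewrite /Q inE => /eqP cJ.
  rewrite mul1n -cJ -card_bd_exponents_fiber // -[RHS]sum1_card.
  apply: eq_bigl => b.
  apply/andP/setIdP => [[/setIdP[bP _] gJ]|[bP gJ]]; split=> //.
  by apply/setIdP; split; rewrite // /g (eqP gJ).
- by move=> b b' _ _; apply: mnm_of_ffun_inj.
have card1 b : #|[pred i | mnm_of_ffun b i == 1]| = #|g b|.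
  by apply: eq_card => i; rewrite !inE mnmE.
move=> m; split=> [[/(bd_stan_ffun _ n2)[b bP <-]]|[b]].
  by rewrite card1 => /eqP cb; exists b; rewrite // inE bP.
rewrite inE => /andP[bP /eqP cb] <-; split; last by rewrite card1.
by apply/bd_stan_ffun => //; exists b.
Qed.

End StandardMonomials.

(** * The closed formula over the rationals *)

Import GRing.Theory.

Local Open Scope ring_scope.

(** For m = 0 the right side is t times its inverse, hence 1. This is the case s = n of the
    formula. *)
Lemma nforest_rat (t m : nat) : (0 < t)%N -> (m <= t)%N ->
  (nforest t m)%:Q = (t%:Q - m%:Q) * t%:Q ^ (m%:Z - 1).
Proof.
rewrite -!pmulrn => t0 lemt.
case: m lemt => [|m] ltmt.
  rewrite /nforest subr0 sub0r exprN1 mulfV //.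
  by rewrite Num.Theory.pnatr_eq0 -lt0n.
rewrite intS addrAC subrr add0r -exprnP -[LHS](addrK (m.+1 * t ^ m)%:R).
by rewrite -natrD (nforestD ltmt) natrM !natrX exprS; ring.
Qed.

Theorem theorem3p7 (K : fieldType) (n : nat) (n_ge2 : (2 <= n)%N) :
  (forall s : nat, (2 <= s <= n)%N ->
     O_count K n s = uprooted_count n (s - 1) /\
     (O_count K n s)%:Q =
       'C(n, s)%:Q * (s%:Q - 1) * (n%:Q - 1) ^ (n%:Z - s%:Z - 1)) /\
  ncard (bd_stan K n) = ((n - 1) ^ (n - 1))%N.
Proof.
split=> [s /andP[s2 sn]|]; last by rewrite card_bd_stan // subn1.
rewrite O_countE // uprooted_countE; split.
  by congr (binomial _ _ * nforest _ _)%N; lia.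
(* Here t = n - 1 and m = n - s, so t - m = s - 1. *)
rewrite PoszM intrM nforest_rat; [|lia|lia].
rewrite mulrA; congr (_ * _ * _).
  rewrite -!pmulrn natrB // -subn1 natrB; last by lia.
  by ring.
rewrite -subn1 -!subzn //; last by lia.
by rewrite intrB.
Qed.
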